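(* Let $K$ be a field, $X=\{x_1,x_2,\ldots\}$ a finite or countable set, $P=K[X\times\mathbb{N}^*]$, $\sigma:P\to P$ the algebra endomorphism $x_i(j)\mapsto x_i(j+1)$, $S=P[s;\sigma]$, and let $R\subset S$ be the subalgebra generated by the elements $x_i(1)s$. Let $I$ be a graded two-sided ideal of $R$ and let $J$ be the extension of $I$ to $S$, that is, the (multigraded) two-sided ideal of $S$ generated by $I$. If $G$ is a multi-homogeneous basis of $J$, then $G\cap R$ is a (homogeneous) basis of $I$. In particular, the contraction $J\cap R$ equals $I$; that is, $I\mapsto J$ is a bijective correspondence between all graded two-sided ideals of $R$ and their extensions to $S$.
   Context: $\mathbb{N}^*=\{1,2,\ldots\}$; $P=K[X\times\mathbb{N}^*]$ is the commutative polynomial ring in the variables $x_i(j)=(x_i,j)$. $S=P[s;\sigma]$ is the skew polynomial ring: the free left $P$-module with basis $\{s^i\}_{i\ge0}$ and multiplication determined by $sf=\sigma(f)s$ ($f\in P$). It is graded by $S_i=Ps^i$, and $R$ is graded by $R_i=R\cap S_i$ ($R$ is the image of the embedding $\iota:K\langle X\rangle\to S$, $x_i\mapsto x_i(1)s$). Multidegree: for a monomial $m=x_{i_1}(j_1)\cdots x_{i_d}(j_d)$ of $P$ put $\partial(m)=(\mu_k)_{k\in\mathbb{N}^*}$ with $\mu_k=\#\{\alpha\mid j_\alpha=k\}$; $P_\mu$ is the span of monomials of multidegree $\mu$, and $S_{\mu,i}=P_\mu s^i$, so $S=\bigoplus_{\mu,i}S_{\mu,i}$. Elements of the $S_{\mu,i}$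 are called multi-homogeneous; an ideal $J\subset S$ is multigraded if $J=\sum_{\mu,i}(J\cap S_{\mu,i})$. ''Basis'' of a two-sided ideal means a generating set of it as a two-sided ideal (of $S$ for $J$, of $R$ for $I$); a multi-homogeneous basis is one consisting of multi-homogeneous elements. *)

(* Defs.v *)
From HB Require Import structures.
From mathcomp Require Import all_boot all_order all_algebra.
From mathcomp Require Import finmap.
From mathcomp.multinomials Require Import monalg.
From mathcomp Require Import boolp classical_sets functions.

Set Implicit Arguments.
Unset Strict Implicit.
Unset Printing Implicit Defensive.

Import GRing.Theory.

Local Open Scope classical_set_scope.
Local Open Scope ring_scope.

(* R[s; sigma], an element being given by the polynomial of its coefficients,
   written on the left of the powers of s.  It is a new type, so that its
   product cannot be confused with that of {poly R}. *)
Record skewpoly (R : nzRingType) (sigma : {rmorphism R -> R}) : predArgType :=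
  Skewpoly { poly_of_skew : {poly R} }.

Section SkewPolynomialRing.
Context (R : nzRingType) (sigma : {rmorphism R -> R}).

Local Notation skew := (skewpoly sigma).
Local Notation Skew := (Skewpoly sigma).

HB.instance Definition _ := [isNew for @poly_of_skew R sigma].
HB.instance Definition _ := [Choice of skew by <:].

Lemma poly_of_skew_inj : injective (@poly_of_skew R sigma).
Proof. exact: val_inj. Qed.

Definition skew_add (p q : skew) : skew :=
  Skew (poly_of_skew p + poly_of_skew q).
Definition skew_opp (p : skew) : skew := Skew (- poly_of_skew p).
Definition skew_scale (a : R) (p : skew) : skew := Skew (a *: poly_of_skew p).

Fact skew_addA : associative skew_add.
Proof. by move=> p q r; apply: poly_of_skew_inj; exact: addrA. Qed.
Fact skew_addC : commutative skew_add.
Proof. by move=> p q; apply: poly_of_skew_inj; exact: addrC. Qed.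
Fact skew_add0 : left_id (Skew 0) skew_add.
Proof. by move=> p; apply: poly_of_skew_inj; exact: add0r. Qed.
Fact skew_addN : left_inverse (Skew 0) skew_opp skew_add.
Proof. by move=> p; apply: poly_of_skew_inj; exact: addNr. Qed.

HB.instance Definition _ := GRing.isZmodule.Build skew
  skew_addA skew_addC skew_add0 skew_addN.

Fact skew_scaleA a b p : skew_scale a (skew_scale b p) = skew_scale (a * b) p.
Proof. by apply: poly_of_skew_inj; exact: scalerA. Qed.
Fact skew_scale1 : left_id 1 skew_scale.
Proof. by move=> p; apply: poly_of_skew_inj; exact: scale1r. Qed.
Fact skew_scaleDr : right_distributive skew_scale +%R.
Proof. by move=> a p q; apply: poly_of_skew_inj; exact: scalerDr. Qed.
Fact skew_scaleDl p : {morph skew_scale^~ p : a b / a + b}.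
Proof. by move=> a b; apply: poly_of_skew_inj; exact: scalerDl. Qed.

HB.instance Definition _ := GRing.Zmodule_isLmodule.Build R skew
  skew_scaleA skew_scale1 skew_scaleDr skew_scaleDl.

Definition skew_coef (p : skew) (i : nat) : R := (poly_of_skew p)`_i.

Definition skew_mul_def (p q : skew) : skew :=
  Skew (\poly_(k < (size (poly_of_skew p) + size (poly_of_skew q)).-1)
     \sum_(j < k.+1) skew_coef p j * iter j sigma (skew_coef q (k - j))).
Fact skew_mul_key : unit. Proof. by []. Qed.
Definition skew_mul := locked_with skew_mul_key skew_mul_def.
Canonical skew_mul_unlockable := [unlockable fun skew_mul].

Lemma skewP (p q : skew) : skew_coef p =1 skew_coef q <-> p = q.
Proof. by split=> [/polyP/poly_of_skew_inj|->]. Qed.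

Lemma skew_coefD (p q : skew) i :
  skew_coef (p + q) i = skew_coef p i + skew_coef q i.
Proof. exact: coefD. Qed.

Lemma skew_coefZ a (p : skew) i : skew_coef (a *: p) i = a * skew_coef p i.
Proof. exact: coefZ. Qed.

Lemma iter_sigma0 j : iter j sigma 0 = 0.
Proof. by elim: j => //= j ->; rewrite rmorph0. Qed.

Lemma iter_sigma1 j : iter j sigma 1 = 1.
Proof. by elim: j => //= j ->; rewrite rmorph1. Qed.

Lemma iter_sigmaD j : {morph iter j sigma : a b / a + b}.
Proof. by move=> a b; elim: j => //= j ->; rewrite rmorphD. Qed.

Lemma iter_sigmaM j : {morph iter j sigma : a b / a * b}.
Proof. by move=> a b; elim: j => //= j ->; rewrite rmorphM. Qed.

Lemma iter_sigma_sum j I (r : seq I) (P : pred I) (F : I -> R) :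
  iter j sigma (\sum_(i <- r | P i) F i) =
    \sum_(i <- r | P i) iter j sigma (F i).
Proof. exact: (big_morph _ (iter_sigmaD j) (iter_sigma0 j)). Qed.

Lemma skew_coef_mul (p q : skew) i :
  skew_coef (skew_mul p q) i =
    \sum_(j < i.+1) skew_coef p j * iter j sigma (skew_coef q (i - j)).
Proof.
rewrite unlock /skew_mul_def {1}/skew_coef coef_poly ltn_predRL.
case: leqP => // le_pq_i1.
rewrite big1 // => j _; rewrite /skew_coef.
have [lq_p_j|lt_j_p] := leqP (size (poly_of_skew p)) j.
  by rewrite nth_default ?mul0r.
rewrite [(poly_of_skew q)`__]nth_default ?iter_sigma0 ?mulr0 //.
rewrite leq_subRL -ltnS // (leq_trans _ le_pq_i1) // ltn_add2r //.
Qed.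

Fact skew_mulA : associative skew_mul.
Proof.
move=> p q r; apply/skewP=> i; rewrite !skew_coef_mul.
pose a := skew_coef p; pose b := skew_coef q; pose c := skew_coef r.
pose F j l := a j * iter j sigma (b (l - j)%N) * iter l sigma (c (i - l)%N).
transitivity (\sum_(j < i.+1) \sum_(l < i.+1 | (j <= l)%N) F j l).
  apply: eq_bigr => /= j _.
  rewrite skew_coef_mul iter_sigma_sum big_distrr /=.
  have le_ji : (j <= i)%N by rewrite -ltnS.
  rewrite -(big_mkord (fun l => (j <= l)%N) (fun l => F j l)).
  rewrite (big_cat_nat _ (n := j)) //=; last exact: leqW.
  rewrite [X in _ = X + _]big_nat_cond [X in _ = X + _]big_pred0 ?add0r; last first.
    by move=> l; apply/negP => /andP[/andP[_ lj]]; rewrite leqNgt lj.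
  rewrite -[X in index_iota X _](add0n j) big_addn subSn // big_mkord.
  apply: eq_big => [l|l _]; first by rewrite leq_addl.
  by rewrite iter_sigmaM -iterD /F mulrA addnK [(l + j)%N]addnC subnDA.
rewrite (exchange_big_dep predT) //=; apply: eq_bigr => l _.
rewrite skew_coef_mul big_distrl /=.
rewrite -(big_mkord (fun j => (j <= l)%N) (fun j => F j l)).
rewrite (big_cat_nat _ (n := l.+1)) //=.
rewrite [X in _ + X]big_nat_cond [X in _ + X]big_pred0 ?addr0; last first.
  by move=> j; apply/negP => /andP[/andP[lj _]]; rewrite leqNgt lj.
by rewrite big_mkord; apply: eq_bigl => j; rewrite -ltnS ltn_ord.
Qed.

Fact skew_mul1l : left_id (Skew 1) skew_mul.
Proof.
move=> p; apply/skewP=> i; rewrite skew_coef_mul big_ord_recl subn0.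
rewrite big1 => [|j _]; rewrite {1}/skew_coef coef1 ?mul0r //.
by rewrite mul1r addr0.
Qed.

Fact skew_mul1r : right_id (Skew 1) skew_mul.
Proof.
move=> p; apply/skewP=> i; rewrite skew_coef_mul big_ord_recr /= subnn.
rewrite big1 => [|j _]; rewrite {2}/skew_coef coef1.
  by rewrite eqxx iter_sigma1 mulr1 add0r.
by rewrite subn_eq0 leqNgt ltn_ord /= iter_sigma0 mulr0.
Qed.

Fact skew_mulDl : left_distributive skew_mul +%R.
Proof.
move=> p q r; apply/skewP=> i; rewrite skew_coefD !skew_coef_mul -big_split /=.
by apply: eq_bigr => j _; rewrite skew_coefD mulrDl.
Qed.

Fact skew_mulDr : right_distributive skew_mul +%R.
Proof.
move=> p q r; apply/skewP=> i; rewrite skew_coefD !skew_coef_mul -big_split /=.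
by apply: eq_bigr => j _; rewrite skew_coefD iter_sigmaD mulrDr.
Qed.

Fact skew_oner_neq0 : (Skew 1) != 0.
Proof. by apply/eqP => /(congr1 (@poly_of_skew R sigma))/eqP; rewrite oner_eq0. Qed.

HB.instance Definition _ := GRing.Zmodule_isNzRing.Build skew
  skew_mulA skew_mul1l skew_mul1r skew_mulDl skew_mulDr skew_oner_neq0.

Lemma skew_coefM (p q : skew) i :
  skew_coef (p * q) i =
    \sum_(j < i.+1) skew_coef p j * iter j sigma (skew_coef q (i - j)).
Proof. exact: skew_coef_mul. Qed.

Fact skew_scaleAl (a : R) (p q : skew) : a *: (p * q) = (a *: p) * q.
Proof.
apply/skewP=> i; rewrite skew_coefZ !skew_coefM big_distrr /=.
by apply: eq_bigr => j _; rewrite skew_coefZ mulrA.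
Qed.

HB.instance Definition _ :=
  GRing.Lmodule_isLalgebra.Build R skew skew_scaleAl.

Definition skewX : skew := Skew 'X.

Lemma skew_coefX i : skew_coef skewX i = (i == 1)%:R.
Proof. exact: coefX. Qed.

Lemma skew_coef1 i : skew_coef 1 i = (i == 0)%:R.
Proof. exact: coef1. Qed.

Lemma skew_coefXM (p : skew) i :
  skew_coef (skewX * p) i =
    if i is i'.+1 then sigma (skew_coef p i') else 0.
Proof.
rewrite skew_coefM; case: i => [|i].
  by rewrite big_ord_recl big_ord0 skew_coefX mul0r addr0.
rewrite 2!big_ord_recl big1 => [|j _]; rewrite skew_coefX ?mul0r //.
by rewrite add0r addr0 skew_coefX mul1r /= /bump /= add1n subSS subn0.
Qed.

Lemma skew_coefXn n i : skew_coef (skewX ^+ n) i = (i == n)%:R.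
Proof.
elim: n i => [|n IH] i; first exact: skew_coef1.
rewrite exprS skew_coefXM; case: i => // i.
by rewrite IH eqSS; case: eqP; rewrite ?rmorph1 ?rmorph0.
Qed.

(* The powers of s form a basis of the left R-module R[s; sigma]. *)
Lemma skew_coefE (p : skew) :
  p = \sum_(i < size (poly_of_skew p)) skew_coef p i *: skewX ^+ i.
Proof.
apply/skewP=> k.
rewrite (big_morph (fun q : skew => skew_coef q k) (id1 := 0) (op1 := +%R));
  last 2 first.
- by move=> u v; rewrite skew_coefD.
- exact: coef0.
rewrite (eq_bigr (fun i : 'I_(size (poly_of_skew p)) =>
    if i == k :> nat then skew_coef p k else 0)); last first.
  move=> i _; rewrite skew_coefZ skew_coefXn eq_sym.
  by case: eqP => [->|]; rewrite ?mulr1 ?mulr0.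
rewrite -big_mkcond /=; have [lt_k|le_k] := ltnP k (size (poly_of_skew p)).
  by rewrite (big_pred1 (Ordinal lt_k)).
rewrite big_pred0 => [|i]; first exact: nth_default.
by apply/eqP => eik; move: le_k; rewrite -eik leqNgt ltn_ord.
Qed.

Lemma skewX_comm (a : R) : skewX * a%:A = sigma a *: skewX.
Proof.
apply/skewP=> k; rewrite skew_coefXM skew_coefZ skew_coefX.
case: k => [|k]; first by rewrite mulr0.
rewrite skew_coefZ skew_coef1 eqSS.
by case: eqP; rewrite ?mulr1 ?mulr0 ?rmorph0.
Qed.

End SkewPolynomialRing.

Section Ideals.
Context (T : nzRingType).

Definition two_sided_ideal (A I : set T) : Prop :=
  [/\ I `<=` A, zmod_closed [in I] &
      forall a x, A a -> I x -> I (a * x) /\ I (x * a)].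

(* The two-sided ideal of the subring A generated by G `<=` A. *)
Definition ideal_gen (A G : set T) : set T := smallest (two_sided_ideal A) G.

Definition generates_ideal (A I G : set T) : Prop :=
  G `<=` A /\ ideal_gen A G = I.

(* Finite sums of elements of the members of the family F. *)
Definition sum_family (C : Type) (F : C -> set T) : set T :=
  [set x | exists2 r : seq T,
     (forall y, y \in r -> exists c, F c y) & x = \sum_(y <- r) y].

Definition graded_by (C : Type) (F : C -> set T) (I : set T) : Prop :=
  I = sum_family (fun c => I `&` F c).

End Ideals.

Definition npos : Type := {j : nat | (0 < j)%N}.
HB.instance Definition _ := Choice.on npos.

Definition npos1 : npos := exist _ 1%N isT.
Definition npos_succ (j : npos) : npos := exist _ (val j).+1 (ltn0Sn (val j)).

Section LetterplaceRing.
Context (K : fieldType) (X : countType).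

Definition pvar : Type := (X * npos)%type.
HB.instance Definition _ := Choice.on pvar.

Definition Pring : Type := {malg K[{cmonom pvar}]}.
HB.instance Definition _ := GRing.ComAlgebra.on Pring.

Definition x_ (i : X) (j : npos) : Pring := << ucm (i, j) >>%M.

Definition shift_mon (m : {cmonom pvar}) : Pring :=
  \prod_(v <- finsupp m) x_ v.1 (npos_succ v.2) ^+ m v.

Fact shift_mon_mmorphism : mmorphism shift_mon.
Proof.
have shiftE (d : {fset pvar}) (m : {cmonom pvar}) : (finsupp m `<=` d)%fset ->
    shift_mon m = \prod_(v <- d) x_ v.1 (npos_succ v.2) ^+ m v.
  move=> le; rewrite /shift_mon (big_fset_incl _ le) // => v _.
  by rewrite -cmE_neq0 negbK => /eqP ->; rewrite expr0.
split=> [m1 m2|]; last by rewrite /shift_mon mdom1 big_seq_fset0.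
rewrite (shiftE _ _ (fsubset_refl _)) mdomD.
rewrite (shiftE _ m1 (fsubsetUl _ (finsupp m2))).
rewrite (shiftE _ m2 (fsubsetUr (finsupp m1) _)).
by rewrite -big_split /=; apply: eq_bigr => v _; rewrite cmM exprD.
Qed.
HB.instance Definition _ :=
  isMultiplicative.Build {cmonom pvar} Pring shift_mon shift_mon_mmorphism.

Definition sigma : {rmorphism Pring -> Pring} := mmap (@malgC {cmonom pvar} K) shift_mon.

Lemma sigma_x i j : sigma (x_ i j) = x_ i (npos_succ j).
Proof.
rewrite /sigma /= mmapU mul1r /= /shift_mon mdomU big_seq_fset1 cmUU.
by rewrite expr1.
Qed.

Lemma sigmaZ (c : K) (f : Pring) : sigma (c *: f) = c *: sigma f.
Proof. by rewrite /sigma /= mmapZ mul_malgC. Qed.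

Definition Sring : Type := skewpoly sigma.
HB.instance Definition _ := GRing.Lalgebra.on Sring.

Definition svar : Sring := skewX sigma.

Lemma svar_comm (f : Pring) : svar * f%:A = sigma f *: svar.
Proof. exact: skewX_comm. Qed.

(* S is a left P-algebra: K acts through the constants of P. *)
Definition subalgebra (A : set Sring) : Prop :=
  subring_closed [in A] /\ forall (c : K) f, A f -> A ((c%:A : Pring) *: f).

Definition Rsub : set Sring :=
  smallest subalgebra [set f | exists i, f = x_ i npos1 *: svar].

Definition S_deg (i : nat) : set Sring := [set p *: svar ^+ i | p in [set: Pring]].
Definition R_deg (i : nat) : set Sring := Rsub `&` S_deg i.

Definition multidegree (m : {cmonom pvar}) (k : npos) : nat :=
  (\sum_(v <- finsupp m | v.2 == k) m v)%N.

(* The K-span of the monomials of multidegree mu; it is 0 when mu does not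
   have finite support. *)
Definition P_mdeg (mu : npos -> nat) : set Pring :=
  smallest (fun V : set Pring => submod_closed [in V])
    [set f | exists2 m, multidegree m = mu & f = << m >>].

Definition S_mdeg (c : (npos -> nat) * nat) : set Sring :=
  [set p *: svar ^+ c.2 | p in P_mdeg c.1].

Definition homogeneous_R (f : Sring) : Prop := exists i, R_deg i f.
Definition multihomogeneous (f : Sring) : Prop := exists c, S_mdeg c f.

Definition graded_ideal_R (I : set Sring) : Prop :=
  two_sided_ideal Rsub I /\ graded_by R_deg I.

Definition multigraded (J : set Sring) : Prop := graded_by S_mdeg J.

Definition extension (I : set Sring) : set Sring := ideal_gen [set: Sring] I.

Definition multihomogeneous_basis (J G : set Sring) : Prop :=
  generates_ideal [set: Sring] J G /\ forall g, G g -> multihomogeneous g.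

Definition homogeneous_basis_R (I G : set Sring) : Prop :=
  generates_ideal Rsub I G /\ forall g, G g -> homogeneous_R g.

End LetterplaceRing.

Arguments Rsub : clear implicits.

(* Main.v *)
Require Import Defs.
From mathcomp Require Import all_boot all_algebra.
From mathcomp Require Import finmap.
From mathcomp.multinomials Require Import monalg.
From mathcomp Require Import boolp classical_sets functions.
From mathcomp Require Import zify.

Set Implicit Arguments.
Unset Strict Implicit.
Unset Printing Implicit Defensive.

Import GRing.Theory.

Local Open Scope classical_set_scope.
Local Open Scope ring_scope.

(* A term [m s^i] has a weight (multidegree of m, i), and weights multiply by
   (mu, i)(nu, j) = (mu + shift^i nu, i + j), so S is graded by them and R is
   the sum of the components of weight e_d = (1^d, d).  The key fact is that if
   f in I has weight e_d and a f b has weight e_D, then a f b already lies in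
   R I R: the variables of a with index beyond its power of s can be moved to
   the right of f.  Hence the weight e_D components of the elements a f b
   spanning J are in I, which gives the contraction.  For the basis G, one
   argues by induction on D: in a product a g b of weight e_D, either g has
   weight e_D, so that g is in R and the key fact applies to the ideal of R
   generated by the elements of G in R, or g is a sum of terms a' f b' with f
   in I of weight e_d, d < D (d = D would force g to have weight e_D). *)

(** * Weights and their products *)

Section Multidegrees.

Definition npos_add (i : nat) (k : npos) : npos :=
  exist _ (i + val k)%N (ltn_addl i (valP k)).

(** The effect on multidegrees of [sigma] iterated i times. Truncated subtraction sends the indices
    up to i to 0, where [insub] fails, so these get the default value 0. *)
Definition shiftm (i : nat) (mu : npos -> nat) (k : npos) : nat :=
  if insub (val k - i)%N is Some k' then mu k' else 0%N.

(** The vector 1^d: the multidegree of a product of d variables with indices 1, ..., d. As indices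
    are positive, [onesm 0] vanishes everywhere. *)
Definition onesm (d : nat) (k : npos) : nat := (val k <= d)%N.

Definition addm (mu nu : npos -> nat) (k : npos) : nat := (mu k + nu k)%N.

Lemma npos_addP (i : nat) (k : npos) :
  (i < val k)%N -> exists k', k = npos_add i k'.
Proof.
move=> ik; have k0 : (0 < val k - i)%N by rewrite subn_gt0.
by exists (exist _ (val k - i)%N k0); apply: val_inj; rewrite /= subnKC // ltnW.
Qed.

Lemma shiftm_le i mu k : (val k <= i)%N -> shiftm i mu k = 0%N.
Proof. by move=> ki; rewrite /shiftm insubF //= (eqP ki). Qed.

Lemma shiftm_add i mu k : shiftm i mu (npos_add i k) = mu k.
Proof.
rewrite /shiftm /= addKn.
by case: insubP => [u _ uk|/negP[]]; [congr mu; apply: val_inj|exact: valP].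
Qed.

Lemma shiftm0 mu : shiftm 0 mu = mu.
Proof.
apply/funext => k; rewrite -[RHS](shiftm_add 0 mu); congr shiftm.
exact: val_inj.
Qed.

Lemma shiftmD i mu nu :
  shiftm i (addm mu nu) = addm (shiftm i mu) (shiftm i nu).
Proof. by apply/funext => k; rewrite /shiftm /addm; case: insub. Qed.

Lemma shiftm_shiftm i j mu : shiftm i (shiftm j mu) = shiftm (i + j) mu.
Proof.
apply/funext => k; have [ki|/npos_addP[k' ->]] := leqP (val k) i.
  by rewrite !shiftm_le // (leq_trans ki) // leq_addr.
rewrite shiftm_add; have [kj|/npos_addP[k'' ->]] := leqP (val k') j.
  by rewrite !shiftm_le //= leq_add2l.
rewrite shiftm_add -[in LHS](shiftm_add (i + j) mu); congr shiftm.
by apply: val_inj; rewrite /= addnA.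
Qed.

(** The shift by i places the indices 1, ..., d right after 1, ..., i. This is what makes the span
    of the weights e_d closed under products. *)
Lemma shiftm_ones i d :
  addm (onesm i) (shiftm i (onesm d)) = onesm (i + d).
Proof.
apply/funext => k; have [ki|/npos_addP[k' ->]] := leqP (val k) i.
  by rewrite /addm shiftm_le // addn0 /onesm ki (leq_trans ki) // leq_addr.
rewrite /addm shiftm_add /onesm /= leq_add2l -[X in (_ <= X)%N]addn0.
by rewrite leq_add2l leqNgt (valP k').
Qed.

(* The product of S maps [S_mdeg c] times [S_mdeg c'] into [S_mdeg (mulw c c')]. *)
Definition mulw (c c' : (npos -> nat) * nat) : (npos -> nat) * nat :=
  (addm c.1 (shiftm c.2 c'.1), (c.2 + c'.2)%N).

(** The weight e_d; its component turns out to be the degree d part of R, see [R_degE]. *)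
Definition Rw (d : nat) : (npos -> nat) * nat := (onesm d, d).

Lemma mulw_Rw i d : mulw (Rw i) (Rw d) = Rw (i + d).
Proof. by rewrite /mulw /= shiftm_ones. Qed.

End Multidegrees.

(** * Induction on commutative monomials *)

Section Monomials.
Context (I : choiceType).

Lemma cmonom_split (m : {cmonom I}) v : v \in finsupp m ->
  exists m', m = mmul (ucm v) m'.
Proof.
rewrite -cmE_neq0 => mv; exists (divcm m (ucm v)); apply/eqP/cmP => w.
rewrite cmM divcmE cmU; case: eqP => [<-|_]; last by rewrite subn0.
by rewrite subnKC // lt0n.
Qed.

Lemma cmonom_ind (Q : {cmonom I} -> Prop) :
  Q mone -> (forall v m, Q m -> Q (mmul (ucm v) m)) -> forall m, Q m.
Proof.
move=> Q1 QM m; move: {2}(mdeg m) (erefl (mdeg m)) => n.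
elim: n m => [m /mdeg_eq0I -> //|n IH m mn].
have [m0|[v mv]] := fset_0Vmem (finsupp m).
  by move: mn; rewrite mdegE m0 big_seq_fset0.
have [m' mE] := cmonom_split mv; rewrite mE; apply/QM/IH.
by move: mn; rewrite mE mdegM mdegU => -[].
Qed.

End Monomials.

(** * Multidegrees of monomials *)

Section MonomialMultidegrees.
Context (X : countType).
Implicit Types m : {cmonom (pvar X)}.

(** Enlarging the index set adds only zero exponents. A common index set for two monomials and their
    product is what [multidegreeM] needs. *)
Lemma multidegreeEw (d : {fset pvar X}) m k : (finsupp m `<=` d)%fset ->
  multidegree m k = (\sum_(v <- d | v.2 == k) m v)%N.
Proof.
move=> le; rewrite /multidegree [LHS]big_mkcond [RHS]big_mkcond /=.
rewrite (big_fset_incl _ le) // => v _.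
by rewrite -cmE_neq0 negbK => /eqP ->; rewrite if_same.
Qed.

Lemma multidegreeM m m' :
  multidegree (mmul m m') = addm (multidegree m) (multidegree m').
Proof.
apply/funext => k; rewrite /addm (multidegreeEw _ (fsubset_refl _)) mdomD.
rewrite (multidegreeEw _ (fsubsetUl (finsupp m) (finsupp m'))).
rewrite (multidegreeEw _ (fsubsetUr (finsupp m) (finsupp m'))) -big_split /=.
by apply: eq_bigr => v _; rewrite cmM.
Qed.

Lemma multidegree1 : multidegree (mone : {cmonom (pvar X)}) = onesm 0.
Proof.
apply/funext => k; rewrite /multidegree big_mkcond mdom1 big_seq_fset0 /onesm.
by rewrite leqNgt (valP k).
Qed.

Lemma multidegreeU v k : multidegree (ucm v : {cmonom (pvar X)}) k = (v.2 == k).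
Proof.
rewrite /multidegree big_mkcond mdomU big_seq_fset1 cmUU.
by case: eqP.
Qed.

Lemma multidegree_neq0 m k :
  multidegree m k != 0%N -> exists2 v, v.2 = k & v \in finsupp m.
Proof.
elim/cmonom_ind: m => [|v m IH]; first by rewrite multidegree1 /onesm leqNgt (valP k).
rewrite multidegreeM /addm multidegreeU; case: (v.2 =P k) => [vk _|_ /IH[w wk wm]].
  by exists v; rewrite // mdomD inE mdomU inE eqxx.
by exists w; rewrite // mdomD inE wm orbT.
Qed.

Lemma multidegree_eq1 m : multidegree m = onesm 0 -> m = mone.
Proof.
elim/cmonom_ind: m => // v m _ /(congr1 (fun f => f v.2)).
by rewrite multidegreeM /addm multidegreeU eqxx /onesm leqNgt (valP v.2).
Qed.

(** Each variable goes to the first factor if its index is at most i, and to the second otherwise.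
    In [Rideal_monomialM] the second factor is the part that moves across x. *)
Lemma cmonom_cut i m : exists m1 m2, [/\ m = mmul m1 m2,
  forall k, (i < val k)%N -> multidegree m1 k = 0%N &
  forall k, (val k <= i)%N -> multidegree m2 k = 0%N].
Proof.
have z k : multidegree (mone : {cmonom (pvar X)}) k = 0%N.
  by rewrite multidegree1 /onesm leqNgt (valP k).
elim/cmonom_ind: m => [|v m [m1 [m2 [-> h1 h2]]]].
  by exists mone, mone; split; rewrite ?mulm1 //=.
have [vi|iv] := leqP (val v.2) i.
  exists (mmul (ucm v) m1), m2; split=> //; first by rewrite mulmA.
  move=> k ik; rewrite multidegreeM /addm h1 // multidegreeU addn0.
  by case: eqP ik => // <-; rewrite ltnNge vi.
exists m1, (mmul (ucm v) m2); split=> //; first by rewrite !mulmA (mulmC m1).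
move=> k ki; rewrite multidegreeM /addm h2 // multidegreeU addn0.
by case: eqP ki => // <-; rewrite leqNgt iv.
Qed.

End MonomialMultidegrees.

(** * Multigraded components of P and S, and the projections onto them *)

Section Components.
Context (K : fieldType) (X : countType).
Implicit Types (i j : nat) (f g p q : Pring K X) (x y z : Sring K X) (mu nu : npos -> nat).

Local Notation sg := (@sigma K X).
Local Notation s := (@svar K X).

Lemma P_mdeg_closed mu : submod_closed [in @P_mdeg K X mu].
Proof.
split=> [|a f g].
  by rewrite inE => V [[V0 _] _]; rewrite inE in V0.
rewrite !inE => mf mg V hV; have [[_ VZ] _] := hV.
by have := VZ a f g; rewrite !inE; apply; [exact: mf|exact: mg].
Qed.

Lemma P_mdeg0 mu : P_mdeg mu (0 : Pring K X).
Proof. by have [+ _] := P_mdeg_closed mu; rewrite inE. Qed.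

Lemma P_mdegZD mu (a : K) f g : P_mdeg mu f -> P_mdeg mu g -> P_mdeg mu (a *: f + g).
Proof.
by have [_ h] := P_mdeg_closed mu; move=> mf mg; have := h a f g; rewrite !inE; apply.
Qed.

Lemma P_mdegD mu f g : P_mdeg mu f -> P_mdeg mu g -> P_mdeg mu (f + g).
Proof. by move=> mf mg; rewrite -[f]scale1r; exact: P_mdegZD. Qed.

Lemma P_mdegZ mu (a : K) f : P_mdeg mu f -> P_mdeg mu (a *: f).
Proof. by move=> mf; rewrite -[_ *: _]addr0; apply: P_mdegZD => //; exact: P_mdeg0. Qed.

Lemma P_mdegU m : P_mdeg (multidegree m) (<< m >> : Pring K X).
Proof. by move=> V [_]; apply; exists m. Qed.

(** [Q] is only additive, so minimality of the span cannot be applied to it directly; it is applied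
    to the set of f all of whose scalar multiples are in [Q], which is a submodule. *)
Lemma P_mdeg_ind mu (Q : set (Pring K X)) : Q 0 ->
  (forall f g, Q f -> Q g -> Q (f + g)) ->
  (forall (a : K) m, multidegree m = mu -> Q (a *: << m >>)) ->
  P_mdeg mu `<=` Q.
Proof.
move=> Q0 QD QU f mf.
suff /(_ 1): [set f | forall a : K, Q (a *: f)] f by rewrite scale1r.
apply: mf => /=; split=> [|_ [m mm ->] a]; last exact: QU.
split=> [|a u v]; first by rewrite inE => a; rewrite scaler0.
move=> /set_mem Qu /set_mem Qv; apply/mem_set => b; rewrite scalerDr scalerA.
by apply: QD; [exact: Qu|exact: Qv].
Qed.

Lemma PringE f : f = \sum_(m <- msupp f) f@_m *: (<< m >> : Pring K X).
Proof.
rewrite {1}[f]monalgE; apply: eq_bigr => m _.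
apply/malgP => k; rewrite [RHS]mcoeffZ [X in _ * X]mcoeffU1 [LHS]mcoeffU.
by rewrite mulr_natr.
Qed.

(** Turns membership in a span into a condition on coefficients, which is how the projections are
    computed below. *)
Lemma P_mdegP mu f :
  P_mdeg mu f <-> forall m, f@_m != 0 -> multidegree m = mu.
Proof.
split=> [mf|h].
  suff: [set f | forall m, f@_m != 0 -> multidegree m = mu] f by [].
  move: f mf; apply: P_mdeg_ind => /= [m|f g mf mg m|a m <- k].
  - by rewrite mcoeff0 eqxx.
  - rewrite mcoeffD; have [->|/mf //] := eqVneq f@_m 0.
    by rewrite add0r => /mg.
  - by rewrite mcoeffZ mcoeffU1; case: (m =P k) => [->//|_]; rewrite mulr0 eqxx.
rewrite [f]PringE big_seq; elim/big_ind: _ => [|u v mu' mv|m].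
- exact: P_mdeg0.
- exact: P_mdegD.
- by rewrite -mcoeff_neq0 => /h <-; apply: P_mdegZ; exact: P_mdegU.
Qed.

Lemma malgUM (m n : {cmonom (pvar X)}) :
  << mmul m n >> = << m >> * << n >> :> Pring K X.
Proof. by rewrite malgM_def fgmulUU mulr1. Qed.

Lemma P_mdegM mu nu f g :
  P_mdeg mu f -> P_mdeg nu g -> P_mdeg (addm mu nu) (f * g).
Proof.
move=> mf mg; suff: [set f | P_mdeg (addm mu nu) (f * g)] f by [].
move: f mf; apply: P_mdeg_ind => /= [|u v|a m mm].
- by rewrite mul0r; exact: P_mdeg0.
- by rewrite mulrDl; exact: P_mdegD.
rewrite -scalerAl; apply: P_mdegZ.
suff: [set g | P_mdeg (addm mu nu) (<< m >> * g)] g by [].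
move: g mg; apply: P_mdeg_ind => /= [|u v|b n nn].
- by rewrite mulr0; exact: P_mdeg0.
- by rewrite mulrDr; exact: P_mdegD.
rewrite -scalerAr; apply: P_mdegZ.
by rewrite -malgUM -mm -nn -multidegreeM; exact: P_mdegU.
Qed.

Lemma P_mdeg_sigma mu f : P_mdeg mu f -> P_mdeg (shiftm 1 mu) (sg f).
Proof.
move: f; apply: P_mdeg_ind => /= [|u v|a m <-].
- by rewrite rmorph0; exact: P_mdeg0.
- by rewrite rmorphD; exact: P_mdegD.
rewrite sigmaZ; apply: P_mdegZ => {a}; elim/cmonom_ind: m => [|v m IH].
  rewrite (_ : << _ >> = 1) // rmorph1.
  rewrite (_ : shiftm 1 _ = multidegree (mone : {cmonom (pvar X)})).
    exact: P_mdegU.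
  rewrite multidegree1; apply/funext => k.
  have [k1|/npos_addP[k' ->]] := leqP (val k) 1; last first.
    by rewrite shiftm_add /onesm /= leqNgt (valP k').
  by rewrite shiftm_le // /onesm leqNgt (valP k).
rewrite malgUM (rmorphM sg) multidegreeM shiftmD.
apply: P_mdegM; last exact: IH.
case: v => a b; rewrite (sigma_x K a b).
rewrite (_ : shiftm 1 _ = multidegree (ucm (a, npos_succ b))).
  exact: P_mdegU.
apply/funext => k; rewrite multidegreeU /=.
have [k1|/npos_addP[k' ->]] := leqP (val k) 1.
  rewrite shiftm_le //; case: eqP => // sk.
  by move: k1; rewrite -sk /= ltnNge (valP b).
by rewrite shiftm_add multidegreeU -!val_eqE.
Qed.

Lemma P_mdeg_iter_sigma i mu f : P_mdeg mu f -> P_mdeg (shiftm i mu) (iter i sg f).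
Proof.
elim: i => [|i IH] mf; first by rewrite shiftm0.
by rewrite iterS -add1n -shiftm_shiftm; apply: P_mdeg_sigma; exact: IH.
Qed.

Lemma x_npos_add i a k : x_ K a (npos_add i k) = iter i sg (x_ K a k).
Proof.
elim: i => [|i IH]; first by congr x_; exact: val_inj.
by rewrite iterS -IH sigma_x; congr x_; exact: val_inj.
Qed.

(** Each variable of m has index greater than i, hence is the i-fold shift of a variable. The
    equality is stated in P because [sigma] acts on P and not on monomials. *)
Lemma iter_sigma_monomial i (m : {cmonom (pvar X)}) :
  (forall k, (val k <= i)%N -> multidegree m k = 0%N) ->
  exists n, (<< m >> : Pring K X) = iter i sg << n >>
            /\ multidegree m = shiftm i (multidegree n).
Proof.
move=> h; have [n mE] : exists n, (<< m >> : Pring K X) = iter i sg << n >>.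
  elim/cmonom_ind: m h => [|v m IH] h; first by exists mone; rewrite iter_sigma1.
  have [k ki|n nE] := IH.
    by have /eqP := h k ki; rewrite multidegreeM /addm addn_eq0 => /andP[_ /eqP].
  have iv : (i < val v.2)%N.
    rewrite ltnNge; apply/negP => vi; have := h _ vi.
    by rewrite multidegreeM /addm multidegreeU eqxx.
  have [k vE] := npos_addP iv.
  exists (mmul (ucm (v.1, k)) n); rewrite !malgUM iter_sigmaM nE; congr (_ * _).
  by case: v vE {h IH iv} => a b /= ->; exact: x_npos_add.
exists n; split=> //.
(* The multidegree of m is read off in P: the coefficient of m in itself is 1, so [P_mdegP]
   determines it. *)
have : P_mdeg (shiftm i (multidegree n)) (<< m >> : Pring K X).
  by rewrite mE; apply: P_mdeg_iter_sigma; exact: P_mdegU.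
by move/P_mdegP; apply; rewrite mcoeffUU oner_eq0.
Qed.

Lemma skew_monomM p q i j :
  (p *: s ^+ i) * (q *: s ^+ j) = (p * iter i sg q) *: s ^+ (i + j).
Proof.
rewrite -scalerAl -scalerA; congr (_ *: _).
elim: i => [|i IH]; first by rewrite mul1r.
rewrite exprS -mulrA IH -mulr_algl mulrA svar_comm -scalerAl -exprS.
by rewrite -addSn.
Qed.

Lemma skew_monomM3 p q f i j k :
  (p *: s ^+ i) * (q *: s ^+ j) * (f *: s ^+ k) =
    (p * iter i sg q * iter (i + j) sg f) *: s ^+ (i + j + k).
Proof. by rewrite (skew_monomM p q) (skew_monomM _ f). Qed.

Lemma skew_coef_monom p i j : skew_coef (p *: s ^+ i) j = if j == i then p else 0.
Proof.
by rewrite skew_coefZ skew_coefXn; case: eqP; rewrite ?mulr1 ?mulr0.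
Qed.

Lemma S_mdegE c x : S_mdeg c x <->
  P_mdeg c.1 (skew_coef x c.2) /\ x = skew_coef x c.2 *: s ^+ c.2.
Proof.
split=> [[p mp <-]|[mx xE]]; last by exists (skew_coef x c.2).
by rewrite skew_coef_monom eqxx.
Qed.

Lemma S_mdeg0 c : S_mdeg c (0 : Sring K X).
Proof. by exists 0; [exact: P_mdeg0|rewrite scale0r]. Qed.

Lemma S_mdegM c c' x y :
  S_mdeg c x -> S_mdeg c' y -> S_mdeg (mulw c c') (x * y).
Proof.
move=> [p mp <-] [q mq <-]; rewrite skew_monomM.
exists (p * iter c.2 sg q) => //.
by apply: P_mdegM; [exact: mp|exact: P_mdeg_iter_sigma].
Qed.

Lemma Sring_ind (Q : set (Sring K X)) : Q 0 ->
  (forall x y, Q x -> Q y -> Q (x + y)) ->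
  (forall c x, S_mdeg c x -> Q x) -> forall x, Q x.
Proof.
move=> Q0 QD QS x; rewrite (skew_coefE x); apply: big_ind => // i _.
rewrite [skew_coef _ _]PringE scaler_suml; apply: big_ind => // m _.
apply: (QS (multidegree m, val i)); eexists; last by [].
apply: P_mdegZ; exact: P_mdegU.
Qed.

(** Multidegrees are functions on an infinite set, so their equality is tested classically. *)
Definition P_proj mu f : Pring K X :=
  [malg m in msupp f => if `[< multidegree m = mu >] then f@_m else 0].

Lemma P_projE mu f m :
  (P_proj mu f)@_m = if `[< multidegree m = mu >] then f@_m else 0.
Proof.
rewrite mcoeffE; case: msuppP => // _; by rewrite if_same.
Qed.

Definition S_proj (c : (npos -> nat) * nat) x : Sring K X :=
  P_proj c.1 (skew_coef x c.2) *: s ^+ c.2.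

Lemma S_projD c : {morph S_proj c : x y / x + y}.
Proof.
move=> x y; rewrite /S_proj -scalerDl; congr (_ *: _); apply/malgP => m.
by rewrite mcoeffD !P_projE skew_coefD mcoeffD; case: ifP; rewrite ?addr0.
Qed.

Lemma P_proj_id mu f : P_mdeg mu f -> P_proj mu f = f.
Proof.
move=> /P_mdegP mf; apply/malgP => m; rewrite P_projE; case: asboolP => // mc.
by have [//|/mf] := eqVneq f@_m 0.
Qed.

Lemma S_proj_id c x : S_mdeg c x -> S_proj c x = x.
Proof. by move=> /S_mdegE[mx {2}->]; rewrite /S_proj P_proj_id. Qed.

(** Together with [S_projD] and [S_proj_id], this says that the sum of the components of S is
    direct. *)
Lemma S_proj_neq c c' x : S_mdeg c x -> c <> c' -> S_proj c' x = 0.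
Proof.
move=> [p /P_mdegP mp <-] cc'; rewrite /S_proj skew_coef_monom.
rewrite (_ : P_proj _ _ = 0) ?scale0r //; apply/malgP => m.
rewrite P_projE mcoeff0; case: asboolP => // mc'.
case: eqP => [c2|]; last by rewrite mcoeff0.
have [//|/mp mc] := eqVneq p@_m 0; case: cc'.
by rewrite [c]surjective_pairing [c']surjective_pairing c2 -mc mc'.
Qed.

Lemma S_proj0 c : S_proj c 0 = 0.
Proof. apply: S_proj_id; exact: S_mdeg0. Qed.

End Components.

(** * Two-sided ideals and sums of families *)

Section Ideals.
Context (T : nzRingType).
Implicit Types (A B I G : set T).

Lemma ideal0 A I : two_sided_ideal A I -> I 0.
Proof. by case=> _ [/set_mem]. Qed.

Lemma idealB A I x y : two_sided_ideal A I -> I x -> I y -> I (x - y).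
Proof. by case=> _ [_ IB] _ Ix Iy; apply/set_mem/IB; apply/mem_set. Qed.

Lemma idealD A I x y : two_sided_ideal A I -> I x -> I y -> I (x + y).
Proof.
move=> idI Ix Iy; rewrite -[y]opprK; apply: (idealB idI) => //.
by rewrite -sub0r; apply: (idealB idI) => //; exact: ideal0 idI.
Qed.

Lemma idealMl A I a x : two_sided_ideal A I -> A a -> I x -> I (a * x).
Proof. by case=> _ _ IM Aa Ix; have [] := IM a x Aa Ix. Qed.

Lemma idealMr A I a x : two_sided_ideal A I -> A a -> I x -> I (x * a).
Proof. by case=> _ _ IM Aa Ix; have [] := IM a x Aa Ix. Qed.

(** Opposites come from multiplication by -1, so closure under sums suffices. *)
Lemma two_sided_idealT I : I 0 -> (forall x y, I x -> I y -> I (x + y)) ->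
  (forall a x, I x -> I (a * x) /\ I (x * a)) -> two_sided_ideal [set: T] I.
Proof.
move=> I0 ID IM; split=> // [|a x _]; last exact: IM.
split=> [|x y /set_mem Ix /set_mem Iy]; apply/mem_set => //.
by apply: ID => //; rewrite -mulN1r; have [] := IM (-1) y Iy.
Qed.

(** The intersection stays inside A because A, being a subring, is itself one of the ideals
    intersected. *)
Lemma two_sided_ideal_gen A G :
  subring_closed [in A] -> G `<=` A -> two_sided_ideal A (ideal_gen A G).
Proof.
case=> A1 AB AM GA; have idA : two_sided_ideal A A.
  split=> // [|a x Aa Ax].
    by split=> //; rewrite -(subrr 1); apply: AB.
  by split; apply/set_mem/AM; apply/mem_set.
split=> [x gx||a x Aa gx].
- by apply: gx; split.
- split=> [|x y /set_mem gx /set_mem gy]; apply/mem_set => B [idB GB].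
    exact: ideal0 idB.
  by apply: (idealB idB); [exact: gx|exact: gy].
- split=> B [idB GB].
    by apply: (idealMl idB) => //; exact: gx.
  by apply: (idealMr idB) => //; exact: gx.
Qed.

Lemma ideal_genT A : two_sided_ideal [set: T] (ideal_gen [set: T] A).
Proof. by apply: two_sided_ideal_gen => //; split=> [|x y _ _|x y _ _]; apply/mem_set. Qed.

Context (C : Type) (F : C -> set T).

Lemma sum_family_ind (Q : set T) : Q 0 ->
  (forall x y, Q x -> Q y -> Q (x + y)) -> (forall c, F c `<=` Q) ->
  sum_family F `<=` Q.
Proof.
move=> Q0 QD QF _ [r Fr ->]; rewrite big_seq; apply: big_ind => // y /Fr[c].
exact: QF.
Qed.

Lemma sum_family0 : sum_family F 0.
Proof. by exists [::]; rewrite ?big_nil. Qed.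

Lemma sum_familyD x y : sum_family F x -> sum_family F y -> sum_family F (x + y).
Proof.
move=> [r Fr ->] [r' Fr' ->]; exists (r ++ r'); last by rewrite big_cat.
by move=> z; rewrite mem_cat => /orP[/Fr|/Fr'].
Qed.

Lemma sub_sum_family c : F c `<=` sum_family F.
Proof.
move=> x Fx; exists [:: x]; last by rewrite big_seq1.
by move=> y; rewrite inE => /eqP ->; exists c.
Qed.

End Ideals.

(** * The subalgebra R inside S *)

Section Letterplace.
Context (K : fieldType) (X : countType).
Implicit Types (f g p q : Pring K X) (x y z : Sring K X) (I : set (Sring K X)).

Local Notation sg := (@sigma K X).
Local Notation s := (@svar K X).
Local Notation Rsub := (Rsub K X).

(** Rewrites a scalar of K as a constant of P acting on S, the form in which [subalgebra] states
    closure. *)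
Lemma scaler_algl (a : K) p x : (a *: p) *: x = (a%:A : Pring K X) *: (p *: x).
Proof. by rewrite [RHS]scalerA [X in _ = X *: _]mulr_algl. Qed.

Lemma subalgebra_Rsub : subalgebra Rsub.
Proof.
split=> [|c x Rx A [subA GA]].
  split=> [|x y /set_mem Rx /set_mem Ry|x y /set_mem Rx /set_mem Ry];
    apply/mem_set => A AG; have [[[A1 AB AM] _] _] := AG.
  - exact/set_mem.
  - by apply/set_mem/AB; apply/mem_set; [exact: Rx|exact: Ry].
  - by apply/set_mem/AM; apply/mem_set; [exact: Rx|exact: Ry].
by have [_ AZ] := subA; apply: AZ; exact: Rx.
Qed.

(** Since s^i x_a(1) = x_a(i+1) s^i, the variable of index i+1 splits off on the right as a
    generator x_a(1) s, and what remains has multidegree 1^i. *)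
Lemma Rsub_monomial i (m : {cmonom (pvar X)}) :
  multidegree m = onesm i -> Rsub (<< m >> *: s ^+ i).
Proof.
have [[R1 _ RM] _] := subalgebra_Rsub.
elim: i m => [|i IH] m mi.
  rewrite (multidegree_eq1 mi) expr0 (_ : << _ >> = 1) // scale1r.
  exact/set_mem.
pose k : npos := npos_add i npos1.
have [v vk vm] : exists2 v, v.2 = k & v \in finsupp m.
  by apply: multidegree_neq0; rewrite mi /onesm /= addn1 leqnn.
have [m' mE] := cmonom_split vm.
have m'i : multidegree m' = onesm i.
  apply/funext => l; move: (congr1 (fun h => h l) mi).
  rewrite mE multidegreeM /addm multidegreeU vk /onesm -val_eqE /= addn1.
  by move: (val l) => n; case: eqP; lia.
rewrite (_ : _ *: _ = (<< m' >> *: s ^+ i) * (x_ K v.1 npos1 *: s ^+ 1)).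
  apply/set_mem/RM; apply/mem_set; first exact: IH.
  by move=> A [_]; apply; exists v.1; rewrite expr1.
have xE : (<< ucm v >> : Pring K X) = iter i sg (x_ K v.1 npos1).
  by rewrite -x_npos_add -/k -vk; case: (v).
by rewrite skew_monomM addn1 -xE mulrC -malgUM -mE.
Qed.

(** The coefficient condition defines a subalgebra, closed under products by [shiftm_ones], that
    contains the generators. Conversely, it makes x a combination of the elements of
    [Rsub_monomial]. *)
Lemma RsubP x : Rsub x <-> forall i, P_mdeg (onesm i) (skew_coef x i).
Proof.
have [[R1 RB RM] RZ] := subalgebra_Rsub.
split=> [Rx|h].
  suff: [set x | forall i, P_mdeg (onesm i) (skew_coef x i)] x by [].
  apply: Rx => /=; split=> [|_ [a ->] i]; last first.
    rewrite -[s]expr1 skew_coef_monom; case: eqP => [->|_]; last exact: P_mdeg0.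
    rewrite (_ : onesm 1 = multidegree (ucm (a, npos1))); first exact: P_mdegU.
    apply/funext => k; rewrite multidegreeU /onesm -val_eqE /=.
    by have := valP k; rewrite /=; move: (val k) => n; case: eqP; lia.
  split=> [|c u /= mu i].
    split=> [|u v /set_mem mu /set_mem mv|u v /set_mem mu /set_mem mv];
      apply/mem_set => i /=.
    - rewrite skew_coef1; case: eqP => [->|_]; last exact: P_mdeg0.
      by rewrite -(@multidegree1 X); exact: P_mdegU.
    - rewrite -[- v]scaleN1r skew_coefD skew_coefZ mulN1r -scaleN1r addrC.
      by apply: P_mdegZD; [exact: mv|exact: mu].
    - rewrite skew_coefM; apply: big_ind => [||j _]; first exact: P_mdeg0.
        by move=> *; exact: P_mdegD.
      have ij : i = (j + (i - j))%N by rewrite subnKC // -ltnS.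
      rewrite {1}ij -shiftm_ones.
      by apply: P_mdegM; [exact: mu|apply: P_mdeg_iter_sigma; exact: mv].
  by rewrite skew_coefZ mulr_algl; apply: P_mdegZ; exact: mu.
have R0 : Rsub 0 by rewrite -(subrr 1); apply/set_mem/RB.
have RD u v : Rsub u -> Rsub v -> Rsub (u + v).
  move=> Ru Rv; rewrite (_ : u + v = u - (0 - v)); last by rewrite sub0r opprK.
  apply/set_mem/RB; apply/mem_set => //.
  by apply/set_mem/RB; apply/mem_set.
rewrite (skew_coefE x); apply: big_ind => // i _.
suff: [set p | Rsub (p *: s ^+ i)] (skew_coef x i) by [].
move: (skew_coef x i) (h i); apply: P_mdeg_ind => /= [|u v|a m mi].
- by rewrite scale0r.
- by rewrite scalerDl; exact: RD.
by rewrite scaler_algl; apply: RZ; exact: Rsub_monomial.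
Qed.

Lemma R_degE i x : R_deg i x <-> S_mdeg (Rw i) x.
Proof.
split=> [[/RsubP Rx [p _ px]]|[p mp <-]].
  by exists p => //=; have := Rx i; rewrite -px skew_coef_monom eqxx.
split; last by exists p.
apply/RsubP => j; rewrite skew_coef_monom.
by case: eqP => [->|_]; [exact: mp|exact: P_mdeg0].
Qed.

(** * Products a x b of weight e_D with x in an ideal of R *)

(** The coefficient identity behind moving variables across x: a factor b that is a k-fold shift can
    be absorbed, unshifted, into the last factor. *)
Lemma rmorph_iter_transfer (A : comNzRingType) (th : {rmorphism A -> A}) k
    (a b c e h : A) :
  b = iter k th c -> a * h * iter k th (c * e) = a * b * h * iter k th e.
Proof. by move=> ->; rewrite iter_sigmaM mulrA [a * _ * h]mulrAC. Qed.

(* The variables of [m] of index at most [i] have multidegree (1^i), and the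
   others have index greater than [i + d]: they can be moved to the right of
   [x]. *)
Lemma Rideal_monomialM I i j d D (m n : {cmonom (pvar X)}) x :
  two_sided_ideal Rsub I -> I x -> S_mdeg (Rw d) x ->
  mulw (mulw (multidegree m, i) (Rw d)) (multidegree n, j) = Rw D ->
  I ((<< m >> *: s ^+ i) * x * (<< n >> *: s ^+ j)).
Proof.
move=> idI Ix [f mf fx] [muE DE].
have eqD k : (multidegree m k + shiftm i (onesm d) k
    + shiftm (i + d) (multidegree n) k)%N = onesm D k.
  by rewrite -muE.
have [m1 [m2 [mE m1h m2h]]] := cmonom_cut i m.
(* An index in the range i+1, ..., i+d already occurs once in the shifted weight of x, and 1^D
   allows no second occurrence. *)
have m2d k : (val k <= i + d)%N -> multidegree m2 k = 0%N.
  have [ki _|/npos_addP[k' ->] /=] := leqP (val k) i; first exact: m2h.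
  rewrite leq_add2l => k'd; have := eqD (npos_add i k').
  by rewrite mE multidegreeM /addm shiftm_add /onesm k'd; case: leqP; lia.
have [n2 [n2E n2m]] := iter_sigma_monomial K m2d.
(* At an index up to i neither x nor the right factor contributes, and i is at most D, so m has
   exactly one variable there. *)
have m1E : multidegree m1 = onesm i.
  apply/funext => k; rewrite /onesm; case: leqP => [ki|]; last exact: m1h.
  have := eqD k; rewrite mE multidegreeM /addm m2h // !shiftm_le //; last lia.
  by rewrite /onesm; case: leqP; lia.
(* Beyond i+d only [m2] and the shifted n contribute; lowering indices by i+d leaves 1^j because D =
   i+d+j. *)
have n2nE : multidegree (mmul n2 n) = onesm j.
  apply/funext => k; have := eqD (npos_add (i + d) k).
  rewrite mE multidegreeM multidegreeM /addm n2m !shiftm_add m1h /=; last first.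
    by have := valP k; rewrite /=; lia.
  have -> : npos_add (i + d) k = npos_add i (npos_add d k).
    by apply: val_inj; rewrite /= addnA.
  rewrite shiftm_add /onesm /=; have := valP k; rewrite /= -DE.
  by do 3!case: leqP; lia.
have pE : << m1 >> * iter i sg f * iter (i + d) sg << mmul n2 n >> =
    << m >> * iter i sg f * iter (i + d) sg << n >> :> Pring K X.
  by rewrite (malgUM K n2 n) mE (malgUM K m1 m2); exact: rmorph_iter_transfer.
have E := skew_monomM3 << m1 >> f << mmul n2 n >> i d j.
rewrite pE in E; have E' := skew_monomM3 << m >> f << n >> i d j.
rewrite (_ : _ * _ =
    (<< m1 >> *: s ^+ i) * x * (<< mmul n2 n >> *: s ^+ j)); last first.
  by rewrite -fx; exact: etrans E' (esym E).
exact (idealMr idI (Rsub_monomial n2nE) (idealMl idI (Rsub_monomial m1E) Ix)).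
Qed.

(** [Rideal_monomialM] extends to a and b by additivity, once their scalars are dealt with;
    constants lie in R, so I absorbs them. *)
Lemma RidealM I d D c c' a b x :
  two_sided_ideal Rsub I -> I x -> S_mdeg (Rw d) x ->
  S_mdeg c a -> S_mdeg c' b -> mulw (mulw c (Rw d)) c' = Rw D -> I (a * x * b).
Proof.
move=> idI Ix dx [p mp <-] [q mq <-] cE.
have IZ (t : K) y : I y -> I ((t%:A : Pring K X) *: y).
  have [[R1 _ _] RZ] := subalgebra_Rsub; rewrite -[y in _ *: y]mul1r scalerAl.
  by apply: (idealMl idI); apply: RZ; exact/set_mem.
suff: [set p | I (p *: s ^+ c.2 * x * (q *: s ^+ c'.2))] p by [].
move: p mp; apply: P_mdeg_ind => /= [|u v|t m mm].
- by rewrite scale0r !mul0r; exact: ideal0 idI.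
- by rewrite scalerDl !mulrDl; exact: idealD idI.
rewrite scaler_algl -!scalerAl; apply: IZ.
suff: [set q | I (<< m >> *: s ^+ c.2 * x * (q *: s ^+ c'.2))] q.
  by rewrite /= !scalerAl.
move: q mq; apply: P_mdeg_ind => /= [|u v|u n nn].
- by rewrite scale0r mulr0; exact: ideal0 idI.
- by rewrite scalerDl mulrDr; exact: idealD idI.
(* The scalar of the right factor is absorbed into x: r is in R of weight e_0, so [x * r] is still
   in I and of weight e_d. *)
pose r : Sring K X := (u%:A : Pring K X) *: 1.
have Rr : Rsub r.
  by have [[R1 _ _] RZ] := subalgebra_Rsub; apply: RZ; exact/set_mem.
have dr : S_mdeg (Rw 0) r.
  exists u%:A; last by [].
  by apply: P_mdegZ; rewrite /= -(@multidegree1 X); exact: P_mdegU.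
have nE : (u *: << n >>) *: s ^+ c'.2 = r * (<< n >> *: s ^+ c'.2).
  by rewrite [LHS]scaler_algl -[RHS]scalerAl [X in _ = _ *: X]mul1r.
have mulACA (y v z w : Sring K X) : y * v * (z * w) = y * (v * z) * w.
  by rewrite !mulrA.
rewrite nE mulACA; apply: (Rideal_monomialM (d := d) (D := D) idI).
- exact: (idealMr idI).
- by rewrite -[d in Rw d]addn0 -mulw_Rw; exact: S_mdegM.
- by rewrite mm nn -!surjective_pairing.
Qed.

(** * The extension of an ideal and its contraction *)

(** Indexing by the weights of the three factors makes every member multi-homogeneous of a known
    weight. *)
Definition sandwich I (t : ((npos -> nat) * nat) * nat * ((npos -> nat) * nat)) :
    set (Sring K X) :=
  [set x | exists a f b : Sring K X, [/\ S_mdeg t.1.1 a, I f /\ S_mdeg (Rw t.1.2) f,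
                             S_mdeg t.2 b & x = a * f * b]].

Lemma sandwich_S_mdeg I t :
  sandwich I t `<=` S_mdeg (mulw (mulw t.1.1 (Rw t.1.2)) t.2).
Proof.
move=> _ [a [f [b [ta [_ tf] tb ->]]]].
by apply: S_mdegM tb; exact: S_mdegM.
Qed.

Lemma sub_extension I : I `<=` extension I.
Proof. exact: sub_gen_smallest. Qed.

Lemma sandwich_extension I t : sandwich I t `<=` extension I.
Proof.
move=> _ [a [f [b [_ [If _] _ ->]]]].
apply: (idealMr (ideal_genT I)) => //; apply: (idealMl (ideal_genT I)) => //.
exact: sub_extension.
Qed.

(** Sums of sandwiches form an ideal of S, since a multi-homogeneous factor merges with a or b. They
    contain I because I is graded: its homogeneous elements are sandwiches with a = b = 1. *)
Lemma extension_sandwich I :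
  graded_ideal_R I -> extension I `<=` sum_family (sandwich I).
Proof.
move=> [idI gI]; apply: smallest_sub.
  apply: two_sided_idealT; [exact: sum_family0|exact: sum_familyD|].
  move=> y x Sx; split.
    move: x Sx; apply: sum_family_ind => [|u v|t _ [a [f [b [ta tf tb ->]]]]] /=.
    - by rewrite mulr0; exact: sum_family0.
    - by rewrite mulrDr; exact: sum_familyD.
    move: y; apply: Sring_ind => [|u v|c y cy].
    - by rewrite mul0r; exact: sum_family0.
    - by rewrite mulrDl; exact: sum_familyD.
    apply: (sub_sum_family (c := (mulw c t.1.1, t.1.2, t.2))).
    by exists (y * a), f, b; split; rewrite ?mulrA //; exact: S_mdegM.
  move: x Sx; apply: sum_family_ind => [|u v|t _ [a [f [b [ta tf tb ->]]]]] /=.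
  - by rewrite mul0r; exact: sum_family0.
  - by rewrite mulrDl; exact: sum_familyD.
  move: y; apply: Sring_ind => [|u v|c y cy].
  - by rewrite mulr0; exact: sum_family0.
  - by rewrite mulrDr; exact: sum_familyD.
  apply: (sub_sum_family (c := (t.1.1, t.1.2, mulw t.2 c))).
  by exists a, f, (b * y); split; rewrite ?mulrA //; exact: S_mdegM.
rewrite {1}gI; apply: sum_family_ind.
- exact: sum_family0.
- exact: sum_familyD.
move=> d x [Ix /R_degE dx].
apply: (sub_sum_family (c := (Rw 0, d, Rw 0))).
have S1 : S_mdeg (Rw 0) (1 : Sring K X).
  by apply/R_degE; split; [have [[/set_mem]] := subalgebra_Rsub|exists 1; rewrite ?scale1r].
by exists 1, x, 1; rewrite mul1r mulr1.
Qed.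

(** A sandwich is multi-homogeneous, so its projection is 0 or itself; in the second case its weight
    is e_D and [RidealM] puts it in I. *)
Lemma proj_extension I D x :
  graded_ideal_R I -> extension I x -> I (S_proj (Rw D) x).
Proof.
move=> gI; have [idI _] := gI.
move=> /(extension_sandwich gI); move: x; apply: sum_family_ind => [|u v|t x tx] /=.
- by rewrite S_proj0; exact: ideal0 idI.
- by rewrite S_projD; exact: idealD idI.
have [tD|tD] := pselect (mulw (mulw t.1.1 (Rw t.1.2)) t.2 = Rw D); last first.
  by rewrite (S_proj_neq (sandwich_S_mdeg tx) tD); exact: ideal0 idI.
have mx := sandwich_S_mdeg tx; rewrite tD in mx; rewrite (S_proj_id mx).
by case: tx => a [f [b [ta [If tf] tb ->]]]; exact: RidealM tD.
Qed.

Lemma Rsub_sum_proj x : Rsub x ->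
  x = \sum_(i < size (poly_of_skew x)) S_proj (Rw i) x.
Proof.
move=> /RsubP Rx; rewrite {1}(skew_coefE x); apply: eq_bigr => i _.
by rewrite /S_proj P_proj_id //; exact: Rx.
Qed.

(** An element of R is the sum of its projections of weights e_i, and [proj_extension] puts each of
    them in I. *)
Lemma extension_Rsub I : graded_ideal_R I -> extension I `&` Rsub = I.
Proof.
move=> gI; have [idI _] := gI; apply/seteqP; split=> [x [Jx Rx]|x Ix].
  rewrite (Rsub_sum_proj Rx); apply: big_ind => [|u v|i _].
  - exact: ideal0 idI.
  - exact: idealD idI.
  - exact: proj_extension.
by split; [exact: sub_extension|have [IR _ _] := idI; exact: IR].
Qed.

(** The sandwiches spanning the extension are multi-homogeneous and lie in it. *)
Lemma multigraded_extension I : graded_ideal_R I -> multigraded (extension I).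
Proof.
move=> gI; apply/seteqP; split=> x.
  move/(extension_sandwich gI); move: x; apply: sum_family_ind => [|u v|t x tx].
  - exact: sum_family0.
  - exact: sum_familyD.
  - apply: (sub_sum_family (c := mulw (mulw t.1.1 (Rw t.1.2)) t.2)).
    by split; [exact: sandwich_extension tx|exact: sandwich_S_mdeg tx].
move: x; apply: sum_family_ind => [|u v|c x []] //.
- exact: ideal0 (ideal_genT I).
- exact: idealD (ideal_genT I).
Qed.

(** * From a multi-homogeneous basis of the extension to a basis of I *)

Lemma S_proj_mul_ind I D x : two_sided_ideal Rsub I ->
  (forall c c' a b, S_mdeg c a -> S_mdeg c' b -> I (S_proj (Rw D) (a * x * b))) ->
  forall a b, I (S_proj (Rw D) (a * x * b)).
Proof.
move=> idI h a b; move: a; apply: Sring_ind => [|u v|c a ca].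
- by rewrite !mul0r S_proj0; exact: ideal0 idI.
- by rewrite !mulrDl S_projD; exact: idealD idI.
move: b; apply: Sring_ind => [|u v|c' b cb].
- by rewrite mulr0 S_proj0; exact: ideal0 idI.
- by rewrite mulrDr S_projD; exact: idealD idI.
exact: h ca cb.
Qed.

Lemma S_proj_RidealM I d D c c' a b x :
  two_sided_ideal Rsub I -> I x -> S_mdeg (Rw d) x ->
  S_mdeg c a -> S_mdeg c' b -> I (S_proj (Rw D) (a * x * b)).
Proof.
move=> idI Ix dx ca cb.
have mx : S_mdeg (mulw (mulw c (Rw d)) c') (a * x * b).
  by apply: S_mdegM cb; exact: S_mdegM.
have [cD|cD] := pselect (mulw (mulw c (Rw d)) c' = Rw D).
  by rewrite cD in mx; rewrite (S_proj_id mx); exact: RidealM cD.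
by rewrite (S_proj_neq mx cD); exact: ideal0 idI.
Qed.

(** If d is at least D, comparing powers of s gives d = D and exponent 0 for all outer factors. No
    shift then remains, and 1^D already exhausts the multidegree, so the outer factors have weight
    e_0. *)
Lemma mulw_Rw_lt c c' d c1 c1' D :
  mulw (mulw c1 (mulw (mulw c (Rw d)) c')) c1' = Rw D ->
  (d < D)%N \/ mulw (mulw c (Rw d)) c' = Rw D.
Proof.
case: c c' c1 c1' => [mu i] [nu j] [mu1 i1] [nu1 j1].
rewrite /mulw /= => -[muE DE]; have [|Dd] := ltnP d D; [by left|right].
have [i0 j0 i10 dD] : [/\ i = 0, j = 0, i1 = 0 & d = D]%N by split; lia.
move: muE; rewrite i0 j0 i10 dD !add0n !shiftm0 => muE.
congr pair; last by rewrite addn0.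
apply/funext => k; move: (congr1 (fun h => h k) muE).
by rewrite /addm; lia.
Qed.

Lemma graded_ideal_basis_sub I (G : set (Sring K X)) :
  graded_ideal_R I -> multihomogeneous_basis (extension I) G ->
  forall D x, I x -> S_mdeg (Rw D) x -> ideal_gen Rsub (G `&` Rsub) x.
Proof.
move=> gI [[_ GJ] Gm]; set I' := ideal_gen _ _.
have idI' : two_sided_ideal Rsub I'.
  by apply: two_sided_ideal_gen => [|x []//]; have [] := subalgebra_Rsub.
elim/ltn_ind => D IH x Ix dx.
(* Quantifying over a and b makes [T] an ideal of S, so it contains the extension as soon as it
   contains G; taking a = b = 1 then gives the claim for x. *)
pose T : set (Sring K X) := [set x | forall a b, I' (S_proj (Rw D) (a * x * b))].
suff GT : G `<=` T.
  have : T x.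
    have : extension I x by exact: sub_extension.
    rewrite -GJ; apply; split=> //.
    apply: two_sided_idealT => [a b|u v Tu Tv a b|c u Tu].
    - by rewrite mulr0 mul0r S_proj0; exact: ideal0 idI'.
    - rewrite mulrDr mulrDl S_projD; apply: (idealD idI'); [exact: Tu|exact: Tv].
    - by split=> a b; [rewrite mulrA|rewrite mulrA -mulrA]; exact: Tu.
  by move=> /(_ 1 1); rewrite mul1r mulr1 S_proj_id.
move=> g Gg; apply: S_proj_mul_ind => // c1 c1' a b ca cb.
have [c cg] := Gm g Gg; have [cD|cD] := pselect (c = Rw D).
  rewrite cD in cg; have /R_degE[Rg _] := cg.
  by apply: S_proj_RidealM idI' _ cg ca cb; exact: sub_gen_smallest.
(* Writing g as its own projection allows an arbitrary decomposition of g into sandwiches: those of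
   weight other than c are killed. *)
rewrite -[g in a * g](S_proj_id cg).
have : sum_family (sandwich I) g.
  by apply: extension_sandwich => //; rewrite -GJ; exact: sub_gen_smallest.
move: g {Gg cg}; apply: sum_family_ind => [|u v Iu Iv|t y ty] /=.
- by rewrite S_proj0 mulr0 mul0r S_proj0; exact: ideal0 idI'.
- by rewrite S_projD mulrDr mulrDl S_projD; exact: (idealD idI').
have my := sandwich_S_mdeg ty.
have [tc|tc] := pselect (mulw (mulw t.1.1 (Rw t.1.2)) t.2 = c); last first.
  by rewrite (S_proj_neq my tc) mulr0 mul0r S_proj0; exact: ideal0 idI'.
rewrite tc in my; rewrite (S_proj_id my).
have mayb : S_mdeg (mulw (mulw c1 (mulw (mulw t.1.1 (Rw t.1.2)) t.2)) c1') (a * y * b).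
  by rewrite tc; apply: S_mdegM cb; exact: S_mdegM.
have [eD|eD] := pselect
    (mulw (mulw c1 (mulw (mulw t.1.1 (Rw t.1.2)) t.2)) c1' = Rw D); last first.
  by rewrite (S_proj_neq mayb eD); exact: ideal0 idI'.
(* The other alternative says c = e_D, which was excluded; so the middle factor of the sandwich has
   degree d < D and the induction hypothesis applies to it. *)
have [dD|] := mulw_Rw_lt eD; last by rewrite tc.
case: ty => a' [f [b' [ta [If tf] tb ->]]].
have -> : a * (a' * f * b') * b = (a * a') * f * (b' * b) by rewrite !mulrA.
exact: S_proj_RidealM idI' (IH _ dD f If tf) tf (S_mdegM ca ta) (S_mdegM tb cb).
Qed.

Lemma homogeneous_basis_Rsub I (G : set (Sring K X)) :
  graded_ideal_R I -> multihomogeneous_basis (extension I) G ->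
  homogeneous_basis_R I (G `&` Rsub).
Proof.
move=> gI bG; have [idI gradI] := gI; have [[_ GJ] Gm] := bG.
split; last first.
  (* For an element of R, being homogeneous only concerns the power of s, which is the second
     component of the weight. *)
  move=> g [/Gm[c [p _ <-]] Rg]; exists c.2; split=> //.
  by exists p.
split=> [g []//|]; apply/seteqP; split.
  apply: smallest_sub => // g [Gg Rg]; rewrite -(extension_Rsub gI); split=> //.
  by rewrite -GJ; exact: sub_gen_smallest.
rewrite {1}gradI; have idI' : two_sided_ideal Rsub (ideal_gen Rsub (G `&` Rsub)).
  by apply: two_sided_ideal_gen => [|x []//]; have [] := subalgebra_Rsub.
apply: sum_family_ind => [|u v|d x [Ix /R_degE dx]].
- exact: ideal0 idI'.
- exact: idealD idI'.
- exact: (graded_ideal_basis_sub gI bG Ix dx).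
Qed.

End Letterplace.

Theorem proposition6p5 (K : fieldType) (X : countType) :
  (forall I : set (Sring K X), graded_ideal_R I ->
     [/\ multigraded (extension I),
         forall G : set (Sring K X),
           multihomogeneous_basis (extension I) G ->
           homogeneous_basis_R I (G `&` Rsub K X)
       & extension I `&` Rsub K X = I]) /\
  set_bij [set I : set (Sring K X) | graded_ideal_R I]
          (@extension K X @` [set I : set (Sring K X) | graded_ideal_R I])
          (@extension K X).
Proof.
split=> [I gI|].
  split; [exact: multigraded_extension| |exact: extension_Rsub].
  by move=> G; exact: homogeneous_basis_Rsub.
split=> [I gI|I I' /set_mem gI /set_mem gI' eqJ|J [I gI <-]].
- by exists I.
(* Injectivity: contraction to R recovers the ideal from its extension. *)
- by rewrite -(extension_Rsub gI) eqJ extension_Rsub.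
- by exists I.
Qed.
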